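(* For any set $\Gamma\cup\{\phi\}$ of formulas in the language of $\mathbf{CPL}^+$: if $\Gamma\vdash\phi$ in the natural deduction system of $\mathbf{CPL}^+$, then $\Gamma\models\phi$.
   Context: Formulas of $\mathbf{CPL}^+$: $\phi::=p_i\mid\neg p_i\mid\bot\mid\mathrm{NE}\mid\phi\wedge\phi\mid\phi\otimes\phi$. A valuation on $N\subseteq\mathbb N$ is $s:N\to\{0,1\}$, a team on $N$ a set of such (a team: on $\mathbb N$). Semantics: $X\models p_i$ iff $s(i)=1$ for all $s\in X$; $X\models\neg p_i$ iff $s(i)=0$ for all $s\in X$; $X\models\bot$ iff $X=\emptyset$; $X\models\mathrm{NE}$ iff $X\neq\emptyset$; $\wedge$ as usual; $X\models\phi\otimes\psi$ iff $X=Y\cup Z$ for some $Y,Z\subseteq X$ with $Y\models\phi$, $Z\models\psi$. $\Gamma\models\phi$: every team satisfying all of $\Gamma$ satisfies $\phi$. Classical formulas: those without $\mathrm{NE}$. $p_i^1=p_i$, $p_i^0=\neg p_i$; empty $\otimes$-disjunction is $\bot$; for a team $X$ on finite $N=\{i_1,\dots,i_n\}$, $\Theta^*_X=\bigotimes_{s\in X}(p_{i_1}^{s(i_1)}\wedge\dots\wedge p_{i_n}^{s(i_n)}\wedge\mathrm{NE})$. A formula is viewed as a string of symbols numbered from the left starting at 1; $[\psi,m]$ denotes the occurrence of the subformula $\psi$ beginning at the $m$-th symbol, and $\phi(\beta/[\psi,m])$ the result of replacing that occurrence by $\beta$. Natural deduction system of $\mathbf{CPL}^+$ ($\Gamma\vdash\phi$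 iff some derivation of $\phi$ has undischarged assumptions in $\Gamma$; metavariables range over all formulas, axioms are specific formulas, no substitution rule). Axiom: $p_i\otimes\neg p_i$ (each $i$). Rules: standard $\wedge$-introduction/elimination; from $\phi$ infer $\phi\otimes\psi$ if $\psi$ does not contain $\mathrm{NE}$; from $\phi$ infer $\phi\otimes\phi$; from $\phi\otimes\psi$, a derivation of $\alpha$ from $\phi$ and one from $\psi$, infer $\alpha$ (discharging $\phi,\psi$), provided $\alpha$ is classical and the other undischarged assumptions of both subderivations are classical; from $\phi\otimes\psi$ and a derivation of $\chi$ from $\psi$ (discharged) infer $\phi\otimes\chi$, provided the other undischarged assumptions of that subderivation are classical; from $\phi\otimes\psi$ infer $\psi\otimes\phi$; from $\phi\otimes(\psi\otimes\chi)$ infer $(\phi\otimes\psi)\otimes\chi$; from $p_i\wedge\neg p_i$ infer $\bot$; from $\phi\otimes\bot$ infer $\phi$; from $\bot\wedge\mathrm{NE}$ infer any $\phi$; from $\phi\otimes(\bot\wedge\mathrm{NE})$ infer $\bot\wedge\mathrm{NE}$; from $\Theta^*_X\wedge\Theta^*_Y$ infer $\bot\wedge\mathrm{NE}$ for distinct teams $X,Y$ on the same finite index set; from $\alpha\wedge(\psi\otimes\chi)$ infer $(\alpha\wedge\psi)\otimes(\alpha\wedge\chi)$ for classical $\alpha$; Strong elimination 1: given a finite index set $N$ with $Y_1,\dots,Y_k$ all nonempty teams on $N$, and an occurrence $[\mathrm{NE},m]$ in $\phi$: from $\phi$ and derivations of $\theta$ from each $\phi(\Theta^*_{Y_j}/[\mathrm{NE},m])$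 (discharged), infer $\theta$; Strong elimination 2: for an occurrence $[\psi,m]$ of a subformula of $\phi$: from $\phi$, a derivation of $\theta$ from $\phi(\psi\wedge\bot/[\psi,m])$ and one from $\phi(\psi\wedge\mathrm{NE}/[\psi,m])$ (discharged), infer $\theta$. *)

(* Defs.v *)
From mathcomp Require Import all_boot finmap.
From mathcomp Require Import classical_sets.

Set Implicit Arguments.
Unset Strict Implicit.
Unset Printing Implicit Defensive.

Local Open Scope classical_set_scope.

Inductive form : Type :=
| Var (i : nat)
| NVar (i : nat)
| Bot
| NE
| And (phi psi : form)
| Tensor (phi psi : form).

Fixpoint classical (phi : form) : bool :=
  match phi with
  | Var _ | NVar _ | Bot => true
  | NE => false
  | And a b | Tensor a b => classical a && classical b
  end.

Definition team : Type := set (nat -> bool).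

Fixpoint sat (X : team) (phi : form) : Prop :=
  match phi with
  | Var i => forall s, X s -> s i = true
  | NVar i => forall s, X s -> s i = false
  | Bot => X = set0
  | NE => X <> set0
  | And a b => sat X a /\ sat X b
  | Tensor a b => exists Y Z : team,
      [/\ Y `<=` X, Z `<=` X, X = Y `|` Z, sat Y a & sat Z b]
  end.

Definition entails (Gamma : set form) (phi : form) : Prop :=
  forall X : team, (forall psi, Gamma psi -> sat X psi) -> sat X phi.

(* A formula as a fully parenthesized string; a negated variable is written
   with two symbols but has no proper subformula. *)
Inductive symbol : Type :=
| SVar (i : nat) | SNeg | SBot | SNE | SAnd | STensor | SLpar | SRpar.

Fixpoint symbols (phi : form) : seq symbol :=
  match phi with
  | Var i => [:: SVar i]
  | NVar i => [:: SNeg; SVar i]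
  | Bot => [:: SBot]
  | NE => [:: SNE]
  | And a b => SLpar :: symbols a ++ SAnd :: symbols b ++ [:: SRpar]
  | Tensor a b => SLpar :: symbols a ++ STensor :: symbols b ++ [:: SRpar]
  end.

(* [subform_at phi m] is the subformula of [phi] beginning at the [m]-th symbol
   of [symbols phi], counting from 1. In a compound formula the left component
   occupies the positions 2, ..., size (symbols a) + 1 and the right one begins
   at position size (symbols a) + 3. *)
Fixpoint subform_at (phi : form) (m : nat) : option form :=
  if m == 1 then Some phi else
  match phi with
  | And a b | Tensor a b =>
      if m <= (size (symbols a)).+1 then subform_at a m.-1
      else subform_at b (m - (size (symbols a)).+2)
  | _ => None
  end.

Definition occurs (psi : form) (m : nat) (phi : form) : Prop :=
  subform_at phi m = Some psi.

(* phi(beta/[psi, m]); [psi] is determined by [m] and [phi]. *)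
Fixpoint replace_at (phi : form) (m : nat) (beta : form) : form :=
  if m == 1 then beta else
  match phi with
  | And a b =>
      if m <= (size (symbols a)).+1 then And (replace_at a m.-1 beta) b
      else And a (replace_at b (m - (size (symbols a)).+2) beta)
  | Tensor a b =>
      if m <= (size (symbols a)).+1 then Tensor (replace_at a m.-1 beta) b
      else Tensor a (replace_at b (m - (size (symbols a)).+2) beta)
  | _ => phi
  end.

Lemma symbols_replace_at (phi psi beta : form) (m : nat) :
  occurs psi m phi ->
  exists u v : seq symbol,
    [/\ m = (size u).+1, symbols phi = u ++ symbols psi ++ v
      & symbols (replace_at phi m beta) = u ++ symbols beta ++ v].
Proof.
rewrite /occurs; elim: phi m => [i|i|||a IHa b IHb|a IHa b IHb] m /=;
  (case: eqP => [->|_];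
    [by case=> <-; exists [::], [::]; rewrite /= !cats0|]) => //;
  case: leqP => [le_m|lt_m] /=.
- move=> /IHa[u [v [Em Ea Er]]]; exists (SLpar :: u).
  exists (v ++ SAnd :: symbols b ++ [:: SRpar]).
  by rewrite /= Ea Er -!catA; split=> //; case: m Em {le_m Er} => //= ? ->.
- move=> /IHb[u [v [Em Ea Er]]]; exists (SLpar :: symbols a ++ SAnd :: u).
  exists (v ++ [:: SRpar]); rewrite /= Ea Er -?catA /= -?catA; split=> //.
  by rewrite size_cat /= -(subnKC lt_m) Em !addSn !addnS.
- move=> /IHa[u [v [Em Ea Er]]]; exists (SLpar :: u).
  exists (v ++ STensor :: symbols b ++ [:: SRpar]).
  by rewrite /= Ea Er -!catA; split=> //; case: m Em {le_m Er} => //= ? ->.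
- move=> /IHb[u [v [Em Ea Er]]]; exists (SLpar :: symbols a ++ STensor :: u).
  exists (v ++ [:: SRpar]); rewrite /= Ea Er -?catA /= -?catA; split=> //.
  by rewrite size_cat /= -(subnKC lt_m) Em !addSn !addnS.
Qed.

Definition lit (i : nat) (b : bool) : form := if b then Var i else NVar i.

Fixpoint bigtensor (l : seq form) : form :=
  match l with
  | [::] => Bot
  | [:: phi] => phi
  | phi :: l' => Tensor phi (bigtensor l')
  end.

Definition fteam (N : {fset nat}) : Type := {set {ffun N -> bool}}.

(* p_{i1}^{s(i1)} /\ (... /\ (p_{in}^{s(in)} /\ NE)), which is NE when N is
   empty. Here and in [Theta] the order is the one given by [enum]; formulas for
   other orders are interderivable with these. *)
Definition theta (N : {fset nat}) (s : {ffun N -> bool}) : form :=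
  foldr (fun i : N => And (lit (val i) (s i))) NE (enum {: N}).

Definition Theta (N : {fset nat}) (X : fteam N) : form :=
  bigtensor [seq theta s | s <- enum X].

Definition only_classical (A : set form) : Prop :=
  forall gamma, A gamma -> classical gamma.

(* [deriv A phi]: there is a derivation of [phi] whose set of undischarged
   assumptions is exactly [A]. Discharging removes the assumption from the set
   and may be vacuous. *)
Inductive deriv : set form -> form -> Prop :=
| d_assume phi :
    deriv [set phi] phi
| d_em i :
    deriv set0 (Tensor (Var i) (NVar i))
| d_andI A B phi psi :
    deriv A phi -> deriv B psi -> deriv (A `|` B) (And phi psi)
| d_andE1 A phi psi :
    deriv A (And phi psi) -> deriv A phi
| d_andE2 A phi psi :
    deriv A (And phi psi) -> deriv A psi
| d_tensorI A phi psi :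
    classical psi -> deriv A phi -> deriv A (Tensor phi psi)
| d_tensorW A phi :
    deriv A phi -> deriv A (Tensor phi phi)
| d_tensorE A B C phi psi alpha :
    classical alpha ->
    only_classical (B `\ phi) -> only_classical (C `\ psi) ->
    deriv A (Tensor phi psi) -> deriv B alpha -> deriv C alpha ->
    deriv (A `|` (B `\ phi) `|` (C `\ psi)) alpha
| d_tensorSub A B phi psi chi :
    only_classical (B `\ psi) ->
    deriv A (Tensor phi psi) -> deriv B chi ->
    deriv (A `|` (B `\ psi)) (Tensor phi chi)
| d_tensorC A phi psi :
    deriv A (Tensor phi psi) -> deriv A (Tensor psi phi)
| d_tensorA A phi psi chi :
    deriv A (Tensor phi (Tensor psi chi)) ->
    deriv A (Tensor (Tensor phi psi) chi)
| d_botI A i :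
    deriv A (And (Var i) (NVar i)) -> deriv A Bot
| d_botE A phi :
    deriv A (Tensor phi Bot) -> deriv A phi
| d_contraE A phi :
    deriv A (And Bot NE) -> deriv A phi
| d_contraTensor A phi :
    deriv A (Tensor phi (And Bot NE)) -> deriv A (And Bot NE)
| d_contraI A (N : {fset nat}) (X Y : fteam N) :
    X <> Y -> deriv A (And (Theta X) (Theta Y)) -> deriv A (And Bot NE)
| d_distr A alpha psi chi :
    classical alpha ->
    deriv A (And alpha (Tensor psi chi)) ->
    deriv A (Tensor (And alpha psi) (And alpha chi))
| d_strongE1 A phi m chi (N : {fset nat}) (B : fteam N -> set form) :
    occurs NE m phi ->
    deriv A phi ->
    (forall Y : fteam N, Y <> finset.set0 -> deriv (B Y) chi) ->
    deriv (A `|` \bigcup_(Y in [set Y | Y <> finset.set0])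
                   (B Y `\ replace_at phi m (Theta Y))) chi
| d_strongE2 A B C phi psi m chi :
    occurs psi m phi ->
    deriv A phi -> deriv B chi -> deriv C chi ->
    deriv (A `|` (B `\ replace_at phi m (And psi Bot))
             `|` (C `\ replace_at phi m (And psi NE))) chi.

Definition derivable (Gamma : set form) (phi : form) : Prop :=
  exists2 A, A `<=` Gamma & deriv A phi.

(* Main.v *)
(* Classical formulas are flat: they hold in a team iff they hold in each of its
   singleton subteams. Hence classical side assumptions are inherited by the
   subteams that a tensor splits off, which gives soundness of the tensor rules.
   The formula [Theta Y] holds in a team exactly when the restriction of the
   team to the index set is [Y]. The strong elimination rules hold because
   replacing a subformula is compatible with case distinctions on it: if every
   team satisfying [psi] satisfies some [beta i], then every team satisfying
   [phi] satisfies some [phi(beta i/[psi, m])], as a single occurrence of [psi]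
   is evaluated in a single subteam. *)
Require Import Defs.
From mathcomp Require Import all_boot finmap.
From mathcomp Require Import boolp classical_sets.

Set Implicit Arguments.
Unset Strict Implicit.
Unset Printing Implicit Defensive.

Local Open Scope classical_set_scope.

Lemma sat_classicalP (alpha : form) (X : team) : classical alpha ->
  sat X alpha <-> forall s, X s -> sat [set s] alpha.
Proof.
elim: alpha X => [i|i|||a IHa b IHb|a IHa b IHb] X //=.
- by move=> _; split=> [h s Xs _ -> | h s Xs]; [exact: h | exact: (h s Xs s)].
- by move=> _; split=> [h s Xs _ -> | h s Xs]; [exact: h | exact: (h s Xs s)].
- move=> _; split=> [-> // | h]; rewrite -subset0 => s Xs.
  by have := h s Xs => /(congr1 (@^~ s)) /= <-.
- move=> /andP[ca cb]; have := IHa X ca; have := IHb X cb => -[b1 b2] [a1 a2].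
  split=> [[Xa Xb] s Xs | h]; first by split; [exact: a1 | exact: b1].
  by split; [apply: a2 | apply: b2] => s /h[].
- move=> /andP[ca cb]; split=> [[Y [Z [_ _ -> Ya Zb]]] s YZs | h].
    (* A singleton splits into itself and the empty team, on which the other disjunct holds because
       flatness of a classical formula is vacuous there. *)
    case: YZs => [Ys | Zs]; [exists [set s], set0 | exists set0, [set s]].
      split=> //; first by rewrite setU0.
        by apply: (proj1 (IHa Y ca)).
      by apply/(IHb set0 cb).
    split=> //; first by rewrite set0U.
      by apply/(IHa set0 ca).
    by apply: (proj1 (IHb Z cb)).
  (* The split is made pointwise: each valuation goes to every part whose disjunct its singleton
     satisfies, and the parts may overlap. *)
  exists [set s | X s /\ sat [set s] a], [set s | X s /\ sat [set s] b].
  split=> [s [] | s [] | | |] //.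
  + apply/seteqP; split=> [s Xs | s [[]|[]]] //.
    have [Y [Z [_ _ E Ya Zb]]] := h s Xs.
    have : (Y `|` Z) s by rewrite -E.
    by case=> [Ys | Zs]; [left; split=> //; apply: (proj1 (IHa Y ca))
                        | right; split=> //; apply: (proj1 (IHb Z cb))].
  + by apply/(IHa _ ca) => s [].
  + by apply/(IHb _ cb) => s [].
Qed.

Lemma sat_classicalS (alpha : form) (X Y : team) :
  classical alpha -> Y `<=` X -> sat X alpha -> sat Y alpha.
Proof.
move=> ca YX Xa; apply/(sat_classicalP Y ca) => s /YX.
exact: (proj1 (sat_classicalP X ca)).
Qed.

Lemma sat_classicalU (alpha : form) (X Y : team) :
  classical alpha -> sat X alpha -> sat Y alpha -> sat (X `|` Y) alpha.
Proof.
move=> ca Xa Ya; apply/(sat_classicalP _ ca) => s [].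
  exact: (proj1 (sat_classicalP X ca)).
exact: (proj1 (sat_classicalP Y ca)).
Qed.

Lemma sat_classical0 (alpha : form) : classical alpha -> sat set0 alpha.
Proof. by move=> ca; apply/(sat_classicalP _ ca). Qed.

Lemma sat_tensor_bot (X : team) (phi : form) :
  sat X (Tensor phi Bot) <-> sat X phi.
Proof.
split=> [[Y [Z [_ _ -> Yp /= ->]]] | Xp]; first by rewrite setU0.
by exists X, set0; split=> //; rewrite setU0.
Qed.

Lemma sat_discharge (X : team) (B : set form) (phi : form) :
  (forall psi, (B `\ phi) psi -> sat X psi) -> sat X phi ->
  forall psi, B psi -> sat X psi.
Proof.
move=> h Xphi psi Bpsi; have [->//|ne] := pselect (psi = phi).
exact: h.
Qed.

(** For the tensor rules: a subderivation is evaluated in the subteam [Y], where the discharged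
    formula holds by the split and the other assumptions by downward closure of classical
    formulas. *)
Lemma sat_discharge_sub (X Y : team) (B : set form) (phi : form) :
  only_classical (B `\ phi) -> Y `<=` X ->
  (forall psi, (B `\ phi) psi -> sat X psi) -> sat Y phi ->
  forall psi, B psi -> sat Y psi.
Proof.
move=> cB YX h; apply: sat_discharge => psi Bpsi.
by apply: (@sat_classicalS _ X) => //; [exact: cB | exact: h].
Qed.

(** Each step of the descent enters one component, and at a tensor one subteam, leaving the other
    untouched, so the index found at the occurrence serves for the whole formula. The index type is
    nonempty teams for the first strong elimination and [bool] for the second. *)
Lemma sat_replace_at (I : Type) (beta : I -> form) (psi phi : form) (m : nat) :
  (forall X, sat X psi -> exists i, sat X (beta i)) -> occurs psi m phi ->
  forall X, sat X phi -> exists i, sat X (replace_at phi m (beta i)).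
Proof.
move=> h; rewrite /occurs.
elim: phi m => [i|i|||a IHa b IHb|a IHa b IHb] m /=;
  (case: eqP => [_ [E] X Xp | _]; [by apply: h; rewrite -E|]) => //;
  case: leqP => _.
- by move=> /IHa{}IH X [/IH[i Xi] Xb]; exists i.
- by move=> /IHb{}IH X [Xa /IH[i Xi]]; exists i.
- by move=> /IHa{}IH X [Y [Z [YX ZX E /IH[i Yi] Zb]]]; exists i, Y, Z.
- by move=> /IHb{}IH X [Y [Z [YX ZX E Ya /IH[i Zi]]]]; exists i, Y, Z.
Qed.

Lemma sat_lit (X : team) (i : nat) (b : bool) :
  sat X (lit i b) <-> forall s, X s -> s i = b.
Proof. by case: b. Qed.

Definition vrestrict (N : {fset nat}) (s : nat -> bool) : {ffun N -> bool} :=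
  [ffun i : N => s (val i)].

Lemma sat_theta (N : {fset nat}) (f : {ffun N -> bool}) (X : team) :
  sat X (theta f) <-> X <> set0 /\ forall s, X s -> vrestrict N s = f.
Proof.
(* Generalized from the enumeration of [N] to any list of indices, for induction; the innermost [NE]
   gives nonemptiness. *)
have E (l : seq N) :
    sat X (foldr (fun i : N => And (lit (val i) (f i))) NE l) <->
    X <> set0 /\ forall s, X s -> {in l, forall i, s (val i) = f i}.
  elim: l => [|i l IHl] /=; first by split=> // -[].
  split=> [[/sat_lit Xi /IHl[X0 Xl]] | [X0 h]].
    split=> // s Xs j; rewrite inE => /predU1P[->|]; first exact: Xi.
    exact: Xl.
  split; first by apply/sat_lit => s Xs; apply: (h s Xs); rewrite mem_head.
  by apply/IHl; split=> // s Xs j jl; apply: (h s Xs); rewrite inE jl orbT.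
rewrite /theta; split=> [/E[X0 h] | [X0 h]].
  by split=> // s Xs; apply/ffunP => i; rewrite ffunE h // mem_enum.
by apply/E; split=> // s Xs i _; rewrite -(h s Xs) ffunE.
Qed.

(** Makes the recursion uniform: [bigtensor] puts no final [Bot] after the last disjunct, but
    tensoring with [Bot] does not affect satisfaction. *)
Lemma sat_bigtensor_cons (X : team) (phi : form) (l : seq form) :
  sat X (bigtensor (phi :: l)) <-> sat X (Tensor phi (bigtensor l)).
Proof. by case: l => [|psi l] //; split=> /sat_tensor_bot. Qed.

(** Each [theta f] claims a nonempty part of the team restricting to [f] alone, and these parts
    cover the team. *)
Lemma sat_Theta (N : {fset nat}) (F : fteam N) (X : team) :
  sat X (Theta F) <-> forall f, f \in F <-> exists2 s, X s & vrestrict N s = f.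
Proof.
have E (l : seq {ffun N -> bool}) (Y : team) :
    sat Y (bigtensor [seq theta f | f <- l]) <->
    forall f, f \in l <-> exists2 s, Y s & vrestrict N s = f.
  elim: l Y => [|g l IHl] Y.
    split=> [/= -> f | h]; first by split=> // -[].
    apply/seteqP; split=> // s Ys; have /= := h (vrestrict N s).
    by case=> _ h'; have := h' (ex_intro2 _ _ s Ys erefl).
  rewrite map_cons sat_bigtensor_cons; split.
    move=> [U [V [_ _ -> /sat_theta[/eqP/set0P[u Uu] Ug] /IHl Vl]]] f.
    rewrite inE; split.
      move=> /predU1P[->|/Vl[s Vs sf]]; first by exists u; [left | exact: Ug].
      by exists s; [right|].
    move=> [s [Us|Vs] <-]; first by rewrite (Ug s Us) eqxx.
    by apply/orP; right; apply/Vl; exists s.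
  (* If [g] recurs in [l], its valuations go to both parts, since the later copies of [theta g] need
     a nonempty part too. *)
  move=> h; exists [set s | Y s /\ vrestrict N s = g].
  exists [set s | Y s /\ vrestrict N s \in l].
  split=> [s [] | s [] | | |] //.
  - apply/seteqP; split=> [s Ys | s [[]|[]]] //.
    have : vrestrict N s \in g :: l by apply/h; exists s.
    by rewrite inE => /predU1P[]; [left | right].
  - apply/sat_theta; split=> [|s []//].
    have [s Ys sg] : exists2 s, Y s & vrestrict N s = g.
      by apply/h; rewrite mem_head.
    by apply/eqP/set0P; exists s.
  - apply/IHl => f; split=> [fl | [s [_ sl] <- //]].
    have [s Ys sf] : exists2 s, Y s & vrestrict N s = f.
      by apply/h; rewrite inE fl orbT.
    by exists s => //; split; rewrite ?sf.
by rewrite /Theta E; split=> h f; rewrite -h mem_enum.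
Qed.

Lemma sat_Theta_inj (N : {fset nat}) (F G : fteam N) (X : team) :
  sat X (Theta F) -> sat X (Theta G) -> F = G.
Proof.
move=> /sat_Theta hF /sat_Theta hG; apply/setP => f.
by apply/idP/idP => [/hF/hG | /hG/hF].
Qed.

Lemma sat_NE_Theta (N : {fset nat}) (X : team) : sat X NE ->
  exists F : {F : fteam N | F <> finset.set0}, sat X (Theta (proj1_sig F)).
Proof.
move=> /eqP/set0P[s Xs].
(* The witness consists of the restrictions to [N] of all valuations in [X]. *)
pose F : fteam N := [set f | `[< exists2 s, X s & vrestrict N s = f >]]%SET.
have FP f : f \in F <-> exists2 s, X s & vrestrict N s = f.
  by rewrite inE; split=> /asboolP.
have F0 : F <> finset.set0.
  move=> /setP/(_ (vrestrict N s)); rewrite finset.in_set0 => /negP; apply.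
  by apply/FP; exists s.
by exists (exist _ F F0); apply/sat_Theta.
Qed.

Lemma deriv_entails (A : set form) (phi : form) : deriv A phi -> entails A phi.
Proof.
elim=> {A phi}.
- by move=> phi X; apply.
(* The team splits by the value at [i]. *)
- move=> i X _; exists [set s | X s /\ s i = true].
  exists [set s | X s /\ s i = false].
  split=> [s [] | s [] | | s [] | s []] //.
  apply/seteqP; split=> [s Xs | s [[]|[]]] //.
  by case E: (s i); [left | right].
- move=> A B phi psi _ IHA _ IHB X h.
  by split; [apply: IHA | apply: IHB] => chi ?; apply: h; [left | right].
- by move=> A phi psi _ IH X /IH[].
- by move=> A phi psi _ IH X /IH[].
- move=> A phi psi cpsi _ IH X /IH Xphi; exists X, set0.
  by split=> //; [rewrite setU0 | exact: sat_classical0].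
- by move=> A phi _ IH X /IH Xphi; exists X, X; split=> //; rewrite setUid.
- move=> A B C phi psi alpha calpha cB cC _ IHA _ IHB _ IHC X h.
  have [|Y [Z [YX ZX -> Yphi Zpsi]]] := IHA X.
    by move=> chi ?; apply: h; left; left.
  (* The conclusion is obtained on each part separately; being classical, it passes to the union. *)
  apply: sat_classicalU => //.
    apply: IHB; apply: (sat_discharge_sub cB YX) => // chi ?.
    by apply: h; left; right.
  by apply: IHC; apply: (sat_discharge_sub cC ZX) => // chi ?; apply: h; right.
- move=> A B phi psi chi cB _ IHA _ IHB X h.
  have [|Y [Z [YX ZX E Yphi Zpsi]]] := IHA X.
    by move=> xi ?; apply: h; left.
  exists Y, Z; split=> //; apply: IHB.
  by apply: (sat_discharge_sub cB ZX) => // xi ?; apply: h; right.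
- move=> A phi psi _ IH X /IH[Y [Z [YX ZX E Yphi Zpsi]]].
  by exists Z, Y; split=> //; rewrite setUC.
- move=> A phi psi chi _ IH X /IH[Y [_ [_ _ -> Yphi [Z [W [_ _ -> Zpsi Wchi]]]]]].
  exists (Y `|` Z), W; rewrite setUA; split=> //.
  by exists Y, Z.
- move=> A i _ IH X /IH[Xi XNi]; apply/seteqP; split=> // s Xs.
  by have := Xi s Xs; rewrite XNi.
- by move=> A phi _ IH X /IH/sat_tensor_bot.
- by move=> A phi _ IH X /IH[].
- by move=> A phi _ IH X /IH[Y [Z [_ _ _ _ []]]].
- by move=> A N F G neFG _ IH X /IH[XF XG]; case: neFG; apply: sat_Theta_inj XG.
- move=> A alpha psi chi calpha _ IH X /IH[Xa [Y [Z [YX ZX E Ypsi Zchi]]]].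
  by exists Y, Z; split=> //; split=> //; apply: sat_classicalS Xa.
- move=> A phi m chi N B occ _ IHA _ IHB X h.
  have Xphi : sat X phi by apply: IHA => xi ?; apply: h; left.
  (* A single nonempty [F] works for the whole of [X], so the subderivation for that [F] yields the
     conclusion. *)
  have [[F F0] /= XF] := sat_replace_at (@sat_NE_Theta N) occ Xphi.
  apply: (IHB F F0); apply: sat_discharge XF => xi ?.
  by apply: h; right; exists F.
- move=> A B C phi psi m chi occ _ IHA _ IHB _ IHC X h.
  have Xphi : sat X phi by apply: IHA => xi ?; apply: h; left; left.
  have cases Y : sat Y psi ->
      exists b : bool, sat Y (And psi (if b then Bot else NE)).
    (* [true] marks the empty team, [false] a nonempty one. *)
    by have [Y0|Y0] := pselect (Y = set0); [exists true | exists false].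
  have [[] Xb] := sat_replace_at cases occ Xphi.
    by apply: IHB; apply: sat_discharge Xb => xi ?; apply: h; left; right.
  by apply: IHC; apply: sat_discharge Xb => xi ?; apply: h; right.
Qed.

Theorem theorem5p9 (Gamma : set form) (phi : form) :
  derivable Gamma phi -> entails Gamma phi.
Proof.
by move=> [A sA dA] X h; apply: (deriv_entails dA) => psi /sA; apply: h.
Qed.
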